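(* Let $C\in\mathbb{C}^{n\times n}$ be a sectorial matrix. Then: (i) for any $\theta\in\mathbb{R}$ such that $\Gamma_\theta(C)<\frac{\pi}{2}$, there holds $\Psi_\theta(C)=\theta+[-\Gamma_\theta,\Gamma_\theta]$, where $$\Gamma_\theta=\arcsin\,\min_{\gamma>0}\|\gamma e^{-j\theta}C-I\|;$$ (ii) there holds $\Psi_{\theta^\star}(C)=\theta^\star+[-\Gamma^\star,\Gamma^\star]$, where $$\Gamma^\star=\arcsin\min_{z\in\mathbb{C}}\|zC-I\|,\qquad \theta^\star=-\angle\arg\min_{z\in\mathbb{C}}\|zC-I\|.$$
   Context: $j$ is the imaginary unit, $(\cdot)^H$ the conjugate transpose, $\langle x,y\rangle=x^Hy$, and $\|\cdot\|$ the Euclidean norm of vectors / spectral norm of matrices. A matrix $C\in\mathbb{C}^{n\times n}$ is sectorial if $0\notin W(C)$, where $W(C)=\{x^HCx: x\in\mathbb{C}^n,\|x\|=1\}$. For $x,y\in\mathbb{C}^n$ and $\theta\in\mathbb{R}$, $\angle_\theta(x,y)\in[0,\pi]$ is $\arccos\frac{\mathrm{Re}\langle x,e^{-j\theta}y\rangle}{\|x\|\|y\|}$ if $x\neq0,y\neq0$, and $0$ if $x=0$ or $y=0$. The phase spread is $\Gamma_\theta(C)=\sup_{x\in\mathbb{C}^n}\angle_\theta(x,Cx)$. The $\theta$-segmental phase of $C$ is the interval $\Psi_\theta(C)=[\theta-\Gamma_\theta(C),\theta+\Gamma_\theta(C)]$. For a sectorial $C$, $\theta^\star=\arg\min_{\theta\in\mathbb{R}}\Gamma_\theta(C)$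 denotes the optimal (unique modulo $2\pi$) phase center, and $\Psi_{\theta^\star}(C)$ is the segmental phase of $C$. Part (ii) asserts that this $\theta^\star$ (modulo $2\pi$) and its phase spread are given by the displayed formulas. $\angle z$ is the argument of a complex number $z$. *)

(* Defs.v *)
From HB Require Import structures.
From mathcomp Require Import all_boot all_order all_algebra.
From mathcomp Require Import sesquilinear spectral.
From mathcomp Require Import all_classical all_reals all_analysis.
From mathcomp Require Export complex.

Set Implicit Arguments.
Unset Strict Implicit.
Unset Printing Implicit Defensive.

Import Order.TTheory GRing.Theory Num.Theory.
Local Open Scope classical_set_scope.
Local Open Scope ring_scope.
Local Open Scope sesquilinear_scope.
Local Open Scope complex_scope.

Section SegmentalPhase.
Variable R : realType.

Definition argmin (T : Type) (D : set T) (f : T -> R) : set T :=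
  [set x | D x /\ forall y, D y -> f x <= f y].

(* e^{j t} *)
Definition expj (t : R) : R[i] := cos t +i* sin t.

(* The principal argument, in ]-pi, pi]; its value at 0 is irrelevant. *)
Definition carg (z : R[i]) : R :=
  xget 0 [set t | - pi < t <= pi /\ z = `|z| * expj t].

Section Vectors.
Variable n : nat.
Implicit Types x y : 'cV[R[i]]_n.

Definition inner x y : R[i] := (x ^t* *m y) 0 0.

Definition vnorm x : R := Num.sqrt (complex.Re (inner x x)).

Definition spectral_norm (A : 'M[R[i]]_n) : R :=
  sup [set vnorm (A *m x) | x in [set x | vnorm x = 1]].

Definition numrange (C : 'M[R[i]]_n) : set R[i] :=
  [set inner x (C *m x) | x in [set x | vnorm x = 1]].

Definition sectorial (C : 'M[R[i]]_n) : Prop := ~ numrange C 0.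

Definition angle (theta : R) x y : R :=
  if (x == 0) || (y == 0) then 0
  else acos (complex.Re (inner x (expj (- theta) *: y)) / (vnorm x * vnorm y)).

Definition phase_spread (C : 'M[R[i]]_n) (theta : R) : R :=
  sup [set angle theta x (C *m x) | x in [set: 'cV[R[i]]_n]].

Definition seg_phase (C : 'M[R[i]]_n) (theta : R) : set R :=
  `[theta - phase_spread C theta, theta + phase_spread C theta].

End Vectors.
End SegmentalPhase.

(* Main.v *)
(* Expanding |gamma B x - x|^2 <= s^2 |x|^2, where B = e^{-j theta} C, gives
   gamma^2 |Bx|^2 - 2 gamma Re <x, Bx> + (1 - s^2) |x|^2 <= 0. For a fixed x
   some gamma > 0 satisfies this (s < 1) iff the angle between x and Bx has sine
   at most s and is below pi/2, and the admissible gamma form a compact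
   interval. The intervals of any two vectors meet: a gamma separating them
   would change the sign of gamma |Bv|^2 - Re <v, Bv> along a segment on which
   the quadratic form stays positive, which Cauchy-Schwarz forbids. By Helly's
   theorem on the line one gamma works for all x, whence (i).

   For (ii), write z = gamma e^{-j theta}.  A second-order variation at the point of
   W(C) closest to 0 shows that W(C) lies in an open half-plane away from 0, so that
   some phase spread is below pi/2 and min ||zC - I|| < 1.  By strict convexity of
   the Euclidean norm the minimiser z is unique, and its argument is - theta*. *)
Require Import Defs.
From mathcomp Require Import all_boot all_order all_algebra.
From mathcomp Require Import all_classical all_reals all_analysis.
From mathcomp Require Import ring lra.
Set Implicit Arguments.
Unset Strict Implicit.
Unset Printing Implicit Defensive.
Import Order.TTheory GRing.Theory Num.Theory.
Local Open Scope classical_set_scope.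
Local Open Scope ring_scope.
Local Open Scope complex_scope.

Lemma ReD (R : realType) (z w : R[i]) :
  complex.Re (z + w) = complex.Re z + complex.Re w.
Proof. by case: z w => [a b] [c d]. Qed.

Lemma ImD (R : realType) (z w : R[i]) :
  complex.Im (z + w) = complex.Im z + complex.Im w.
Proof. by case: z w => [a b] [c d]. Qed.

Lemma ReN (R : realType) (z : R[i]) : complex.Re (- z) = - complex.Re z.
Proof. by case: z. Qed.

Lemma Re_conj (R : realType) (z : R[i]) : complex.Re (conjc z) = complex.Re z.
Proof. by case: z. Qed.

Lemma Re_scale (R : realType) (a : R) (z : R[i]) :
  complex.Re (a%:C * z) = a * complex.Re z.
Proof. by case: z => [c d] /=; ring. Qed.

Lemma Im_scale (R : realType) (a : R) (z : R[i]) :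
  complex.Im (a%:C * z) = a * complex.Im z.
Proof. by case: z => [c d] /=; ring. Qed.

Lemma Re_sum (R : realType) (I : finType) (F : I -> R[i]) :
  complex.Re (\sum_i F i) = \sum_i complex.Re (F i).
Proof.
apply: (big_morph (@complex.Re R)) => [z w|//]; exact: ReD.
Qed.

Section InnerProduct.
Variables (R : realType) (n : nat).
Implicit Types (x y z : 'cV[R[i]]_n) (a : R[i]) (A : 'M[R[i]]_n).

Lemma innerE x y : inner x y = \sum_i conjc (x i 0) * y i 0.
Proof. by rewrite /inner mxE; apply: eq_bigr => i _; rewrite !mxE. Qed.

Lemma innerDl x y z : inner (x + y) z = inner x z + inner y z.
Proof.
by rewrite !innerE -big_split; apply: eq_bigr => i _; rewrite !mxE rmorphD mulrDl.
Qed.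

Lemma innerDr x y z : inner x (y + z) = inner x y + inner x z.
Proof. by rewrite /inner mulmxDr mxE. Qed.

Lemma innerZl a x y : inner (a *: x) y = conjc a * inner x y.
Proof.
rewrite !innerE mulr_sumr; apply: eq_bigr => i _.
by rewrite !mxE rmorphM mulrA.
Qed.

Lemma innerZr a x y : inner x (a *: y) = a * inner x y.
Proof. by rewrite /inner -scalemxAr mxE. Qed.

Lemma innerC x y : inner y x = conjc (inner x y).
Proof.
rewrite !innerE rmorph_sum; apply: eq_bigr => i _.
by rewrite rmorphM /= conjcK mulrC.
Qed.

Definition rdot x y : R := complex.Re (inner x y).

Lemma rdotC x y : rdot y x = rdot x y.
Proof. by rewrite /rdot innerC Re_conj. Qed.

Lemma rdotDl x y z : rdot (x + y) z = rdot x z + rdot y z.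
Proof. by rewrite /rdot innerDl ReD. Qed.

Lemma rdotDr x y z : rdot x (y + z) = rdot x y + rdot x z.
Proof. by rewrite /rdot innerDr ReD. Qed.

Lemma rdotZr (r : R) x y : rdot x (r%:C *: y) = r * rdot x y.
Proof. by rewrite /rdot innerZr Re_scale. Qed.

Lemma rdotZl (r : R) x y : rdot (r%:C *: x) y = r * rdot x y.
Proof. by rewrite rdotC rdotZr rdotC. Qed.

Lemma rdotNr x y : rdot x (- y) = - rdot x y.
Proof. by rewrite -scaleN1r /rdot innerZr mulN1r ReN. Qed.

Lemma rdotNl x y : rdot (- x) y = - rdot x y.
Proof. by rewrite rdotC rdotNr rdotC. Qed.

Lemma rdot0l x : rdot 0 x = 0.
Proof. by rewrite -(scale0r x) (rdotZl 0) mul0r. Qed.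

Lemma rdot_sqE x :
  rdot x x = \sum_i (complex.Re (x i 0) ^+ 2 + complex.Im (x i 0) ^+ 2).
Proof.
rewrite /rdot innerE Re_sum; apply: eq_bigr => i _.
by case: (x i 0) => a b /=; ring.
Qed.

Lemma rdot_ge0 x : 0 <= rdot x x.
Proof.
by rewrite rdot_sqE sumr_ge0 // => i _; rewrite addr_ge0 ?sqr_ge0.
Qed.

Lemma rdot_eq0 x : (rdot x x == 0) = (x == 0).
Proof.
apply/idP/eqP => [|->]; last first.
  by rewrite rdot_sqE big1 // => i _; rewrite mxE /= expr0n addr0.
rewrite rdot_sqE psumr_eq0 => [/allP h|i _]; last by rewrite addr_ge0 ?sqr_ge0.
apply/matrixP => i j; rewrite ord1 mxE.
have := h i; rewrite mem_index_enum => /(_ isT).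
rewrite paddr_eq0 ?sqr_ge0 // !sqrf_eq0.
by case: (x i 0) => a b /= /andP[/eqP -> /eqP ->].
Qed.

Lemma inner_self x : inner x x = (rdot x x)%:C.
Proof.
rewrite /rdot; have := innerC x x; case: (inner x x) => a b /= [] /eqP.
by rewrite -subr_eq0 opprK -mulr2n mulrn_eq0 /= => /eqP ->.
Qed.

Lemma vnormE x : vnorm x = Num.sqrt (rdot x x). Proof. by []. Qed.

Lemma vnorm_ge0 x : 0 <= vnorm x. Proof. exact: sqrtr_ge0. Qed.

Lemma sqr_vnorm x : vnorm x ^+ 2 = rdot x x.
Proof. by rewrite vnormE sqr_sqrtr ?rdot_ge0. Qed.

Lemma vnorm_eq0 x : (vnorm x == 0) = (x == 0).
Proof. by rewrite -sqrf_eq0 sqr_vnorm rdot_eq0. Qed.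

Lemma vnorm_gt0 x : (0 < vnorm x) = (x != 0).
Proof. by rewrite lt_neqAle vnorm_ge0 andbT eq_sym vnorm_eq0. Qed.

Lemma vnorm0 : vnorm (0 : 'cV[R[i]]_n) = 0.
Proof. by apply/eqP; rewrite vnorm_eq0. Qed.

Lemma rdot_le_vnorm x y : rdot x y <= vnorm x * vnorm y.
Proof.
have [->|x0] := eqVneq x 0.
  by rewrite vnorm0 mul0r rdot0l.
have [->|y0] := eqVneq y 0.
  by rewrite vnorm0 mulr0 rdotC rdot0l.
have := rdot_ge0 ((vnorm y)%:C *: x - (vnorm x)%:C *: y).
rewrite rdotDl !rdotDr !rdotNl !rdotNr !rdotZl !rdotZr -!sqr_vnorm (rdotC x y).
have xg : 0 < vnorm x by rewrite vnorm_gt0.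
have yg : 0 < vnorm y by rewrite vnorm_gt0.
move=> h; rewrite -(ler_pM2l (mulr_gt0 xg yg)).
move: h; rewrite (_ : _ + _ = 2 * (vnorm x * vnorm y * (vnorm x * vnorm y) -
  vnorm x * vnorm y * rdot x y)); last by ring.
by rewrite pmulr_rge0 ?subr_ge0.
Qed.

Lemma vnormD x y : vnorm (x + y) <= vnorm x + vnorm y.
Proof.
rewrite -(ler_pXn2r (n := 2)) ?nnegrE ?addr_ge0 ?vnorm_ge0 // sqrrD !sqr_vnorm.
rewrite rdotDl !rdotDr (rdotC x y) -subr_ge0.
rewrite [leRHS](_ : _ = 2 * (vnorm x * vnorm y - rdot x y)).
  by rewrite pmulr_rge0 // subr_ge0 rdot_le_vnorm.
by ring.
Qed.

Lemma vnormN x : vnorm (- x) = vnorm x.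
Proof. by rewrite !vnormE rdotNl rdotNr opprK. Qed.

Lemma parallelogram x y :
  vnorm (x + y) ^+ 2 + vnorm (x - y) ^+ 2 = 2 * vnorm x ^+ 2 + 2 * vnorm y ^+ 2.
Proof.
rewrite !sqr_vnorm !rdotDl !rdotDr !rdotNl !rdotNr (rdotC x y).
by move: (rdot x x) (rdot x y) (rdot y y) => *; ring.
Qed.

Lemma sqr_vnormZ a x :
  vnorm (a *: x) ^+ 2 =
  (complex.Re a ^+ 2 + complex.Im a ^+ 2) * vnorm x ^+ 2.
Proof.
rewrite !sqr_vnorm {1}/rdot innerZl innerZr inner_self.
by case: a => c d /=; ring.
Qed.

Lemma vnormZ_real (r : R) x : vnorm (r%:C *: x) = `|r| * vnorm x.
Proof.
apply/eqP; rewrite -(@eqrXn2 _ 2) ?mulr_ge0 ?vnorm_ge0 //.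
by rewrite sqr_vnormZ exprMn real_normK ?num_real //= expr0n addr0.
Qed.

Lemma normalize x : x != 0 ->
  exists2 u, vnorm u = 1 & x = (vnorm x)%:C *: u.
Proof.
move=> x0; exists ((vnorm x)^-1%:C *: x).
  by rewrite vnormZ_real ger0_norm ?invr_ge0 ?vnorm_ge0 // mulVf ?vnorm_eq0.
by rewrite scalerA -rmorphM /= mulfV ?vnorm_eq0 // scale1r.
Qed.

Lemma unit_vector_exists : (0 < n)%N -> exists x, vnorm x = 1.
Proof.
move=> n0; have e0 : const_mx 1 != 0 :> 'cV[R[i]]_n.
  by apply/eqP => /matrixP /(_ (Ordinal n0) 0) /eqP; rewrite !mxE oner_eq0.
by have [u u1 _] := normalize e0; exists u.
Qed.

Lemma vnorm_sum (I : finType) (F : I -> 'cV[R[i]]_n) :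
  vnorm (\sum_i F i) <= \sum_i vnorm (F i).
Proof.
elim/big_ind2: _ => [|x r y s xr ys|//]; first by rewrite vnorm0.
by rewrite (le_trans (vnormD _ _)) ?lerD.
Qed.

Lemma sqr_coord_le x i :
  complex.Re (x i 0) ^+ 2 + complex.Im (x i 0) ^+ 2 <= vnorm x ^+ 2.
Proof.
rewrite sqr_vnorm rdot_sqE (bigD1 i) //= lerDl sumr_ge0 // => k _.
by rewrite addr_ge0 ?sqr_ge0.
Qed.

Lemma operator_bounded A : exists2 M, 0 < M &
  forall x, vnorm (A *m x) <= M * vnorm x.
Proof.
exists (1 + \sum_j vnorm (col j A)).
  by rewrite ltr_pwDl // sumr_ge0 // => j _; exact: vnorm_ge0.
move=> x; have -> : A *m x = \sum_j x j 0 *: col j A.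
  apply/matrixP => i k; rewrite !mxE summxE ord1; apply: eq_bigr => j _.
  by rewrite !mxE mulrC.
rewrite (le_trans (vnorm_sum _)) // mulrDl mul1r ler_wpDl ?vnorm_ge0 //.
rewrite mulr_suml ler_sum // => j _.
rewrite -(ler_pXn2r (n := 2)) ?nnegrE ?mulr_ge0 ?vnorm_ge0 //.
by rewrite sqr_vnormZ exprMn [leRHS]mulrC ler_wpM2r ?sqr_ge0 ?sqr_coord_le.
Qed.

Lemma spectral_normP A : (0 < n)%N -> forall s,
  spectral_norm A <= s <-> forall x, vnorm (A *m x) <= s * vnorm x.
Proof.
move=> n0 s; have [e e1] := unit_vector_exists n0.
have [M M0 AM] := operator_bounded A.
split=> [As x|As]; last first.
  apply: ge_sup => [|_ [x /= x1 <-]]; first by exists (vnorm (A *m e)), e.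
  by rewrite (le_trans (As x)) // x1 mulr1.
have [->|/normalize [u u1 ->]] := eqVneq x 0.
  by rewrite mulmx0 vnorm0 mulr0.
rewrite -scalemxAr !vnormZ_real u1 mulr1 mulrC ler_wpM2r ?normr_ge0 //.
apply: le_trans As; apply: ub_le_sup; last by exists u.
by exists M => _ [y /= y1 <-]; rewrite (le_trans (AM y)) // y1 mulr1.
Qed.

Lemma le_spectral_norm A x : (0 < n)%N ->
  vnorm (A *m x) <= spectral_norm A * vnorm x.
Proof. by move=> n0; exact: (spectral_normP A n0 _).1. Qed.

Lemma spectral_norm_ge0 A : (0 < n)%N -> 0 <= spectral_norm A.
Proof.
move=> n0; have [e e1] := unit_vector_exists n0.
by have := le_spectral_norm A e n0; rewrite e1 mulr1; apply/le_trans/vnorm_ge0.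
Qed.
End InnerProduct.

Section PhaseSpread.
Variables (R : realType) (n : nat).
Implicit Types (x y z : 'cV[R[i]]_n) (C B A : 'M[R[i]]_n) (theta phi : R).

Lemma vnorm_expj t x : vnorm (expj t *: x) = vnorm x.
Proof.
apply/eqP; rewrite -(@eqrXn2 _ 2) ?vnorm_ge0 // sqr_vnormZ /=.
by rewrite cos2Dsin2 mul1r.
Qed.

Lemma angleE theta x y : x != 0 -> y != 0 ->
  angle theta x y =
  acos (rdot x (expj (- theta) *: y) / (vnorm x * vnorm y)).
Proof. by rewrite /angle => /negbTE -> /negbTE ->. Qed.

Lemma angle_ratio theta x y : x != 0 -> y != 0 ->
  -1 <= rdot x (expj (- theta) *: y) / (vnorm x * vnorm y) <= 1.
Proof.
move=> x0 y0; set w := expj _ *: y.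
have p : 0 < vnorm x * vnorm y by rewrite mulr_gt0 ?vnorm_gt0.
rewrite ler_pdivlMr // ler_pdivrMr // mul1r -[vnorm y](vnorm_expj (- theta)).
rewrite rdot_le_vnorm mulN1r lerNl -rdotNr andbT.
by rewrite -(vnormN w) rdot_le_vnorm.
Qed.

Lemma angle_le_pi theta x y : angle theta x y <= pi.
Proof.
have [->|x0] := eqVneq x 0; first by rewrite /angle eqxx pi_ge0.
have [->|y0] := eqVneq y 0; first by rewrite /angle eqxx orbT pi_ge0.
by rewrite angleE // acos_lepi // angle_ratio.
Qed.

Lemma angle_leP theta x y phi : 0 <= phi <= pi ->
  (angle theta x y <= phi) =
  (cos phi * (vnorm x * vnorm y) <= rdot x (expj (- theta) *: y)).
Proof.
move=> /[dup] phiI /andP[phi0 phipi].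
have [->|x0] := eqVneq x 0.
  by rewrite vnorm0 rdot0l mul0r mulr0 lexx /angle eqxx.
have [->|y0] := eqVneq y 0.
  by rewrite scaler0 vnorm0 rdotC rdot0l !mulr0 lexx /angle eqxx orbT.
have p : 0 < vnorm x * vnorm y by rewrite mulr_gt0 ?vnorm_gt0.
rewrite -ler_pdivlMr // angleE //.
have rI := angle_ratio theta x0 y0.
set r := _ / _ in rI *.
rewrite -[in RHS](@acosK R r) ?in_itv //=.
by rewrite !leNgt ltr_cos ?in_itv //= acos_ge0 ?acos_lepi.
Qed.

Lemma phase_spread_leP C theta phi : 0 <= phi <= pi ->
  phase_spread C theta <= phi <->
  forall x, cos phi * (vnorm x * vnorm (C *m x)) <=
            rdot x (expj (- theta) *: C *m x).
Proof.
move=> phiI; split=> [h x|h].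
  rewrite -scalemxAl -angle_leP //; apply: le_trans h.
  apply: ub_le_sup; last by exists x.
  by exists pi => _ [y _ <-]; exact: angle_le_pi.
apply: ge_sup => [|_ [x _ <-]]; first by exists (angle theta 0 (C *m 0)), 0.
by rewrite angle_leP // scalemxAl.
Qed.

Lemma phase_spread_ge0 C theta : 0 <= phase_spread C theta.
Proof.
have -> : 0 = angle theta (0 : 'cV[R[i]]_n) (C *m 0) by rewrite /angle eqxx.
apply: ub_le_sup; last by exists 0.
by exists pi => _ [y _ <-]; exact: angle_le_pi.
Qed.

(* Expanded, [|gamma B x - x| <= s |x|] reads
   [gamma^2 |Bx|^2 + (1 - s^2) |x|^2 <= 2 gamma Re <x, Bx>], and AM-GM bounds
   the left-hand side from below by [2 gamma sqrt (1 - s^2) |x| |Bx|]. *)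
Lemma phase_spread_le_asin C theta gamma s : (0 < n)%N -> 0 < gamma ->
  spectral_norm ((gamma%:C * expj (- theta)) *: C - 1%:M) <= s -> s < 1 ->
  phase_spread C theta <= asin s.
Proof.
move=> n0 g0 gs s1.
have s0 : 0 <= s by apply: le_trans gs; exact: spectral_norm_ge0.
have sI : -1 <= s <= 1 by rewrite (ltW s1) andbT (le_trans _ s0).
have aI : 0 <= asin s <= pi.
  have u : asin s <= pi / 2 by rewrite asin_lepi2.
  have l : 0 <= asin s.
    rewrite leNgt -ltr_sin ?in_itv /= ?u ?asin_geNpi2 //.
      by rewrite asinK ?in_itv //= sin0 -leNgt.
    by rewrite oppr_le0 andbb divr_ge0 ?pi_ge0.
  by rewrite l (le_trans u) // ler_pdivrMr // ler_peMr ?pi_ge0 // ler1n.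
apply/phase_spread_leP => // x; rewrite cos_asin //.
have /(_ x) := (spectral_normP _ n0 _).1 gs.
set B := expj (- theta) *: C.
have -> : (gamma%:C * expj (- theta)) *: C = gamma%:C *: B by rewrite scalerA.
rewrite mulmxBl mul1mx -scalemxAl.
have -> : vnorm (C *m x) = vnorm (B *m x) by rewrite -scalemxAl vnorm_expj.
rewrite -(ler_pXn2r (n := 2)) ?nnegrE ?mulr_ge0 ?vnorm_ge0 //.
rewrite sqr_vnorm rdotDl !rdotDr !rdotNl !rdotNr !rdotZl !rdotZr (rdotC x (B *m x)).
rewrite exprMn -!sqr_vnorm.
set h := rdot _ _; set a := vnorm (B *m x); set b := vnorm x.
set c := Num.sqrt _ => H.
have cE : c ^+ 2 = 1 - s ^+ 2.
  by rewrite sqr_sqrtr // subr_ge0 expr_le1 // ltW.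
rewrite -(ler_pM2l g0).
have : 0 <= (gamma * a - c * b) ^+ 2 by exact: sqr_ge0.
nra.
Qed.

End PhaseSpread.

Lemma quadratic_sign_change (R : realType) (a b c : R) : 0 < a -> c < 0 ->
  exists2 t, 0 <= t <= 1 &
    (1 - t) ^+ 2 * a + 2 * (1 - t) * t * b + t ^+ 2 * c = 0.
Proof.
move=> a0 c0; pose p : {poly R} :=
  - (a%:P * (1 - 'X) ^+ 2 + (2 * b)%:P * ((1 - 'X) * 'X) + c%:P * 'X ^+ 2).
have pE t : p.[t] = - ((1 - t) ^+ 2 * a + 2 * (1 - t) * t * b + t ^+ 2 * c).
  by rewrite /p !hornerE /=; ring.
have [t tI /eqP pt] : exists2 t, 0 <= t <= 1 & root p t.
  apply: poly_ivt => //; rewrite !pE subr0 subrr expr1n !expr0n /=.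
  by rewrite !(mul0r, mul1r, mulr0, addr0, add0r) oppr_le0 oppr_ge0 !ltW.
by exists t => //; apply/eqP; rewrite -oppr_eq0 -pE pt.
Qed.

Lemma separating_point (R : realType) (a1 h1 r1 a2 h2 r2 : R) :
  0 < a1 -> 0 < a2 -> (h2 + r2) / a2 < (h1 - r1) / a1 ->
  exists2 g, g * a1 - h1 < - r1 & r2 < g * a2 - h2.
Proof.
move=> a10 a20; set u := _ / a2; set v := _ / a1 => uv.
pose g := (u + v) / 2; exists g.
  have : g < v by rewrite /g; lra.
  by rewrite /v ltr_pdivlMr //; lra.
have : u < g by rewrite /g; lra.
by rewrite /u ltr_pdivrMr //; lra.
Qed.

Lemma ltr_sqr_of_lt_opp (R : realType) (r x : R) :
  0 <= r -> x < - r -> r ^+ 2 < x ^+ 2.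
Proof.
by move=> r0 xr; rewrite -(sqrrN x) ltr_pXn2r ?nnegrE //; lra.
Qed.
Section Helly.
Variables (R : realType) (n : nat) (B : 'M[R[i]]_n) (c : R).
Implicit Types (x y : 'cV[R[i]]_n) (gamma : R).
Hypotheses (n0 : (0 < n)%N) (c0 : 0 < c).
Hypothesis B_inj : forall x, x != 0 -> B *m x != 0.
Hypothesis B_cone :
  forall x, c * (vnorm x * vnorm (B *m x)) <= rdot x (B *m x).

Let q gamma x y : R := gamma ^+ 2 * rdot (B *m x) (B *m y)
  - gamma * (rdot x (B *m y) + rdot y (B *m x)) + c ^+ 2 * rdot x y.

Let d gamma x y : R := gamma * rdot (B *m x) (B *m y)
  - (rdot x (B *m y) + rdot y (B *m x)) / 2.

Let qE gamma (s t : R) x y :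
  q gamma (s%:C *: x + t%:C *: y) (s%:C *: x + t%:C *: y) =
  s ^+ 2 * q gamma x x + 2 * s * t * q gamma x y + t ^+ 2 * q gamma y y.
Proof.
rewrite /q mulmxDr -!scalemxAr !rdotDl !rdotDr !rdotZl !rdotZr.
rewrite (rdotC x y) (rdotC (B *m x) (B *m y)).
move: (rdot (B *m x) (B *m x)) (rdot (B *m x) (B *m y)) (rdot (B *m y) (B *m y)).
move: (rdot x (B *m x)) (rdot x (B *m y)) (rdot y (B *m x)) (rdot y (B *m y)).
move: (rdot x x) (rdot x y) (rdot y y) => *.
by ring.
Qed.

Let dE gamma (s t : R) x y :
  d gamma (s%:C *: x + t%:C *: y) (s%:C *: x + t%:C *: y) =
  s ^+ 2 * d gamma x x + 2 * s * t * d gamma x y + t ^+ 2 * d gamma y y.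
Proof.
rewrite /d mulmxDr -!scalemxAr !rdotDl !rdotDr !rdotZl !rdotZr.
rewrite (rdotC (B *m x) (B *m y)).
move: (rdot (B *m x) (B *m x)) (rdot (B *m x) (B *m y)) (rdot (B *m y) (B *m y)).
move: (rdot x (B *m x)) (rdot x (B *m y)) (rdot y (B *m x)) (rdot y (B *m y)) => *.
by field.
Qed.

Let a x : R := vnorm (B *m x) ^+ 2.
Let h x : R := rdot x (B *m x).
Let disc x : R := h x ^+ 2 - c ^+ 2 * (a x * vnorm x ^+ 2).

Let q_diag gamma x :
  q gamma x x = gamma ^+ 2 * a x - 2 * gamma * h x + c ^+ 2 * vnorm x ^+ 2.
Proof.
rewrite /q /a /h !sqr_vnorm.
by move: (rdot (B *m x) (B *m x)) (rdot x x) (rdot x (B *m x)) => *; ring.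
Qed.

Let d_diag gamma x : d gamma x x = gamma * a x - h x.
Proof.
rewrite /d /a /h !sqr_vnorm.
by move: (rdot (B *m x) (B *m x)) (rdot x (B *m x)) => *; field.
Qed.

Let disc_ge0 x : 0 <= disc x.
Proof.
rewrite subr_ge0 /a -!exprMn (mulrC (vnorm (B *m x))) ler_pXn2r ?nnegrE //.
- by rewrite !mulr_ge0 ?vnorm_ge0 // ltW.
- by apply: le_trans (B_cone x); rewrite !mulr_ge0 ?vnorm_ge0 // ltW.
Qed.

Let a_gt0 x : x != 0 -> 0 < a x.
Proof. by move=> x0; rewrite exprn_gt0 // vnorm_gt0 B_inj. Qed.

Let aq gamma x : a x * q gamma x x = d gamma x x ^+ 2 - disc x.
Proof.
by rewrite q_diag d_diag /disc; move: (a x) (h x) (vnorm x) => *; ring.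
Qed.

(* On the cone [q gamma > 0] the form [d gamma] does not vanish, and two points
   of that cone are joined inside it by a segment once the sign of one of them
   is chosen so that the cross term of [q gamma] is nonnegative. *)
Let no_sign_change gamma x y : 0 < q gamma x x -> 0 < q gamma y y ->
  0 < d gamma x x -> d gamma y y < 0 -> False.
Proof.
move=> qx qy dx dy.
pose e : R := if 0 <= q gamma x y then 1 else -1.
have eq0 : 0 <= e * q gamma x y.
  rewrite /e; case: ifPn => [|/negbTE]; first by rewrite mul1r.
  by rewrite mulN1r oppr_ge0 => /negbT; rewrite -ltNge => /ltW.
have e2 : e ^+ 2 = 1 by rewrite /e; case: ifP => _; rewrite ?sqrrN expr1n.
have [t /andP[t0 t1] dt] := quadratic_sign_change (e * d gamma x y) dx dy.
pose v : 'cV[R[i]]_n := (1 - t)%:C *: x + (e * t)%:C *: y.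
have dv : d gamma v v = 0.
  rewrite /v dE -[RHS]dt exprMn e2.
  by move: (d gamma x x) (d gamma x y) (d gamma y y) => *; ring.
have qv : 0 < q gamma v v.
  rewrite /v qE exprMn e2 mul1r.
  have T1 : 0 <= (1 - t) * t * (e * q gamma x y).
    by apply: mulr_ge0 => //; apply: mulr_ge0 => //; rewrite subr_ge0.
  have : 0 < (1 - t) ^+ 2 * q gamma x x + t ^+ 2 * q gamma y y.
    have [->|t0'] := eqVneq t 0.
      by rewrite subr0 expr1n mul1r expr0n mul0r addr0.
    apply: ltr_wpDl; first by rewrite mulr_ge0 ?sqr_ge0 // ltW.
    by rewrite mulr_gt0 // exprn_even_gt0.
  have -> : 2 * (1 - t) * (e * t) * q gamma x y =
    2 * ((1 - t) * t * (e * q gamma x y)).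
    by move: (q gamma x y) => *; ring.
  by move=> T0; rewrite addrAC; apply: ltr_wpDr T0; apply: mulr_ge0.
have v0 : v != 0.
  apply: contraTneq qv => ->.
  by rewrite q_diag /a /h mulmx0 rdot0l vnorm0 expr0n !mulr0 subr0 addr0 ltxx.
have := mulr_gt0 (a_gt0 v0) qv.
by rewrite aq dv expr0n sub0r oppr_gt0 ltNge disc_ge0.
Qed.

Let lo x := (h x - Num.sqrt (disc x)) / a x.
Let hi x := (h x + Num.sqrt (disc x)) / a x.

Let lo_le_hi x y : x != 0 -> y != 0 -> lo x <= hi y.
Proof.
move=> x0 y0; rewrite leNgt; apply/negP => lt.
have [g gx' gy'] := separating_point (a_gt0 x0) (a_gt0 y0) lt.
have gx : d g x x < - Num.sqrt (disc x) by rewrite d_diag.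
have gy : Num.sqrt (disc y) < d g y y by rewrite d_diag.
apply: (@no_sign_change g y x).
- rewrite -(pmulr_rgt0 _ (a_gt0 y0)) aq subr_gt0 -[ltLHS]sqr_sqrtr ?disc_ge0 //.
  by rewrite ltr_pXn2r ?nnegrE ?sqrtr_ge0 // ltW // (le_lt_trans _ gy) ?sqrtr_ge0.
- rewrite -(pmulr_rgt0 _ (a_gt0 x0)) aq subr_gt0 -[ltLHS]sqr_sqrtr ?disc_ge0 //.
  exact: ltr_sqr_of_lt_opp (sqrtr_ge0 _) gx.
- exact: le_lt_trans (sqrtr_ge0 _) gy.
- by apply: lt_le_trans gx _; rewrite oppr_le0 sqrtr_ge0.
Qed.

Let lo_gt0 x : x != 0 -> 0 < lo x.
Proof.
move=> x0; have hx : 0 < h x.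
  by apply: lt_le_trans (B_cone x); rewrite !mulr_gt0 ?vnorm_gt0 // B_inj.
rewrite divr_gt0 ?a_gt0 // subr_gt0.
rewrite -[X in _ < X]ger0_norm ?ltW // -sqrtr_sqr ltr_sqrt ?exprn_gt0 //.
rewrite gtrDl oppr_lt0 mulr_gt0 ?exprn_gt0 //.
by rewrite (mulr_gt0 (a_gt0 x0)) ?exprn_gt0 ?vnorm_gt0.
Qed.

(* One-dimensional Helly: the parameters [gamma] admissible for a given [x] form
   the interval [[lo x, hi x]], and these intervals pairwise intersect. *)
Lemma uniform_gamma_exists : exists2 gamma, 0 < gamma &
  forall x, gamma ^+ 2 * vnorm (B *m x) ^+ 2 - 2 * gamma * rdot x (B *m x)
            + c ^+ 2 * vnorm x ^+ 2 <= 0.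
Proof.
have [e e1] := unit_vector_exists R n0.
have e0 : e != 0 by rewrite -vnorm_eq0 e1 oner_eq0.
pose S := [set lo x | x in [set x | x != 0]].
have Sne : S !=set0 by exists (lo e), e.
have lo_sup x : x != 0 -> lo x <= sup S.
  move=> x0; apply: ub_le_sup; last by exists x.
  by exists (hi e) => _ [y y0 <-]; exact: lo_le_hi.
exists (sup S); first exact: lt_le_trans (lo_gt0 e0) (lo_sup _ e0).
move=> x; rewrite -/(a x) -/(h x) -q_diag.
have [->|x0] := eqVneq x 0.
  by rewrite q_diag /a /h mulmx0 rdot0l vnorm0 expr0n !mulr0 subr0 addr0.
have l := lo_sup x x0.
have u : sup S <= hi x by apply: ge_sup => // _ [y y0 <-]; exact: lo_le_hi.
rewrite -(pmulr_rle0 _ (a_gt0 x0)) aq subr_le0 -[leRHS]sqr_sqrtr ?disc_ge0 //.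
rewrite -[leLHS]real_normK ?num_real // ler_pXn2r ?nnegrE ?sqrtr_ge0 //.
rewrite ler_norml d_diag; move: l u; rewrite /lo /hi.
by rewrite ler_pdivrMr ?ler_pdivlMr ?a_gt0 // => l u; apply/andP; split; lra.
Qed.

Lemma spectral_norm_le_of_rdot_ge : c <= 1 -> exists2 gamma, 0 < gamma &
  spectral_norm (gamma%:C *: B - 1%:M) <= Num.sqrt (1 - c ^+ 2).
Proof.
move=> c1; have [g g0 gB] := uniform_gamma_exists; exists g => //.
apply/(spectral_normP _ n0) => x.
rewrite mulmxBl mul1mx -scalemxAl.
rewrite -(ler_pXn2r (n := 2)) ?nnegrE ?mulr_ge0 ?vnorm_ge0 ?sqrtr_ge0 //.
rewrite exprMn (@sqr_sqrtr _ (1 - c ^+ 2)) ?subr_ge0 ?expr_le1 // ?(ltW c0) //.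
rewrite sqr_vnorm rdotDl !rdotDr !rdotNl !rdotNr !rdotZl !rdotZr (rdotC x (B *m x)).
rewrite -!sqr_vnorm; have := gB x.
by move: (rdot _ _) (vnorm _) (vnorm _) => *; nra.
Qed.
End Helly.

Section Compactness.
Import numFieldNormedType.Exports.
Variable R : realType.

Definition complex_continuous (T : topologicalType) (F : T -> R[i]) :=
  continuous (fun v => complex.Re (F v)) /\
  continuous (fun v => complex.Im (F v)).

Lemma complex_continuousD (T : topologicalType) (F G : T -> R[i]) :
  complex_continuous F -> complex_continuous G ->
  complex_continuous (fun v => F v + G v).
Proof.
move=> [Fr Fi] [Gr Gi]; split.
  rewrite (_ : (fun _ => _) = (fun v => complex.Re (F v) + complex.Re (G v))).
    by move=> v; apply: cvgD; [exact: Fr|exact: Gr].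
  by apply/funext => v; case: (F v) (G v) => [? ?] [? ?].
rewrite (_ : (fun _ => _) = (fun v => complex.Im (F v) + complex.Im (G v))).
  by move=> v; apply: cvgD; [exact: Fi|exact: Gi].
by apply/funext => v; case: (F v) (G v) => [? ?] [? ?].
Qed.

Lemma complex_continuousM (T : topologicalType) (F G : T -> R[i]) :
  complex_continuous F -> complex_continuous G ->
  complex_continuous (fun v => F v * G v).
Proof.
move=> [Fr Fi] [Gr Gi]; split.
  rewrite (_ : (fun _ => _) = (fun v =>
    complex.Re (F v) * complex.Re (G v) - complex.Im (F v) * complex.Im (G v))).
    move=> v; apply: cvgB; apply: cvgM;
      by [exact: Fr|exact: Gr|exact: Fi|exact: Gi].
  by apply/funext => v; case: (F v) (G v) => [? ?] [? ?].
rewrite (_ : (fun _ => _) = (fun v =>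
  complex.Re (F v) * complex.Im (G v) + complex.Im (F v) * complex.Re (G v))).
  move=> v; apply: cvgD; apply: cvgM;
    by [exact: Fr|exact: Gr|exact: Fi|exact: Gi].
by apply/funext => v; case: (F v) (G v) => [? ?] [? ?].
Qed.

Lemma complex_continuous_conj (T : topologicalType) (F : T -> R[i]) :
  complex_continuous F -> complex_continuous (fun v => conjc (F v)).
Proof.
move=> [Fr Fi]; split.
  by rewrite (_ : (fun _ => _) = (fun v => complex.Re (F v))) //;
    apply/funext => v; case: (F v).
rewrite (_ : (fun _ => _) = (fun v => - complex.Im (F v))).
  by move=> v; apply: cvgN; exact: Fi.
by apply/funext => v; case: (F v).
Qed.

Lemma complex_continuous_cst (T : topologicalType) (c : R[i]) :
  complex_continuous (fun _ : T => c).
Proof. by split => v; exact: cst_continuous. Qed.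

Lemma complex_continuous_sum (T : topologicalType) (I : finType)
    (F : I -> T -> R[i]) :
  (forall i, complex_continuous (F i)) ->
  complex_continuous (fun v => \sum_i F i v).
Proof.
move=> Fc; elim: (index_enum I) => [|i s IH].
  rewrite (_ : (fun _ => _) = (fun _ => 0)); first exact: complex_continuous_cst.
  by apply/funext => v; rewrite big_nil.
rewrite (_ : (fun _ => _) = (fun v => F i v + \sum_(j <- s) F j v)).
  exact: complex_continuousD.
by apply/funext => v; rewrite big_cons.
Qed.

Lemma continuous_of_modulus (T : topologicalType) (f a b : T -> R) (M : R) :
  continuous a -> continuous b ->
  (forall v w, f v <= f w + (`|a v - a w| + `|b v - b w|) * M) -> continuous f.
Proof.
move=> ac bc fM w; pose dist v := (`|a w - a v| + `|b w - b v|) * M.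
have distc : dist v @[v --> w] --> (0 : R).
  have dc (c : T -> R) : continuous c -> `|c w - c v| @[v --> w] --> (0 : R).
    move=> cc; rewrite -(normr0 R) -(subrr (c w)); apply: cvg_norm.
    by apply: cvgB; [exact: cvg_cst|exact: cc].
  rewrite -(mul0r M) -[X in X * M](addr0 0); apply: cvgM; last exact: cvg_cst.
  by apply: cvgD; exact: dc.
apply: (@squeeze_cvgr _ _ _ _ (fun v => f w - dist v) (fun v => f w + dist v)).
- apply: nearW => v; rewrite lerBlDr fM /=.
  by rewrite /dist [`|a w - _|]distrC [`|b w - _|]distrC fM.
- by rewrite -[X in _ --> X]subr0; apply: cvgB; [exact: cvg_cst|exact: distc].
- by rewrite -[X in _ --> X]addr0; apply: cvgD; [exact: cvg_cst|exact: distc].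
Qed.

Variable n : nat.

(* Identifies R^(2n), whose compact sets are known, with C^n. *)
Definition cvec (v : 'rV[R]_(n + n)) : 'cV[R[i]]_n :=
  \col_i (v 0 (lshift n i) +i* v 0 (rshift n i)).

Lemma cvec_surj x : exists v, cvec v = x.
Proof.
exists (row_mx (\row_i complex.Re (x i 0)) (\row_i complex.Im (x i 0))).
apply/matrixP => i j; rewrite !mxE ord1 -[lshift n i]/(unsplit (inl i)).
rewrite -[rshift n i]/(unsplit (inr i)) !unsplitK !mxE.
by case: (x i 0).
Qed.

Lemma complex_continuous_quad (A : 'M[R[i]]_n) :
  complex_continuous (fun v => inner (cvec v) (A *m cvec v)).
Proof.
have cc i : complex_continuous (fun v => cvec v i 0).
  split.
    rewrite (_ : (fun _ => _) = (fun v : 'rV_(n + n) => v 0 (lshift n i))).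
      exact: coord_continuous.
    by apply/funext => v; rewrite mxE.
  rewrite (_ : (fun _ => _) = (fun v : 'rV_(n + n) => v 0 (rshift n i))).
    exact: coord_continuous.
  by apply/funext => v; rewrite mxE.
rewrite (_ : (fun _ => _) =
  (fun v => \sum_i conjc (cvec v i 0) * \sum_j A i j * cvec v j 0)).
  apply: complex_continuous_sum => i; apply: complex_continuousM.
    exact: complex_continuous_conj.
  apply: complex_continuous_sum => j; apply: complex_continuousM => //.
  exact: complex_continuous_cst.
by apply/funext => v; rewrite innerE; apply: eq_bigr => i _; rewrite !mxE.
Qed.

Lemma sphere_attains_min (A : 'M[R[i]]_n) : (0 < n)%N ->
  exists2 x0, vnorm x0 = 1 & forall x, vnorm x = 1 ->
    complex.Re (inner x0 (A *m x0)) ^+ 2 + complex.Im (inner x0 (A *m x0)) ^+ 2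
    <= complex.Re (inner x (A *m x)) ^+ 2 + complex.Im (inner x (A *m x)) ^+ 2.
Proof.
move=> n0; pose S := [set v : 'rV[R]_(n + n) | vnorm (cvec v) = 1].
pose r v := complex.Re (inner (cvec v) (A *m cvec v)).
pose s v := complex.Im (inner (cvec v) (A *m cvec v)).
pose f v := r v * r v + s v * s v.
have S0 : S !=set0.
  by have [e e1] := unit_vector_exists R n0; have [v ve] := cvec_surj e;
    exists v; rewrite /S /= ve.
have Sclosed : closed S.
  rewrite (_ : S = (fun v => complex.Re (inner (cvec v) (1%:M *m cvec v)))
    @^-1` [set 1]).
    apply: preimage_closed => [v _|]; last exact: closed_eq.
    exact: (complex_continuous_quad 1%:M).1.
  apply/seteqP; split=> v; rewrite /S /= mul1mx -/(rdot _ _) -sqr_vnorm.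
    by move=> ->; rewrite expr1n.
  by move=> /eqP; rewrite sqrf_eq1 => /orP[/eqP //|/eqP h];
    have := vnorm_ge0 (cvec v); rewrite h ler0N1.
have Sbounded : S `<=` [set v | forall i, `[(-1 : R), 1]%classic (v ord0 i)].
  move=> v Sv i; rewrite /= in_itv /= -ler_norml.
  rewrite -(ler_pXn2r (n := 2)) ?nnegrE // expr1n real_normK ?num_real //.
  have vj j : v 0 (lshift n j) ^+ 2 + v 0 (rshift n j) ^+ 2 <= 1.
    by have := sqr_coord_le (cvec v) j; rewrite Sv expr1n mxE.
  case: (split_ordP i) => j ->; apply: le_trans (vj j).
    by rewrite lerDl sqr_ge0.
  by rewrite lerDr sqr_ge0.
have Scompact : compact S.
  apply: subclosed_compact Sclosed _ Sbounded.
  by apply: (@rV_compact R (n + n) (fun=> `[(-1 : R), 1]%classic)) => _;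
    exact: segment_compact.
have [qr qi] := complex_continuous_quad A.
have fc : continuous f.
  have rc : continuous r by exact: qr.
  have sc : continuous s by exact: qi.
  by move=> v; exact: (cvgD (cvgM (rc v) (rc v)) (cvgM (sc v) (sc v))).
have [v vS vmin] := EVT_min_rV S0 Scompact (continuous_subspaceT fc).
exists (cvec v); first by move: vS; rewrite inE.
move=> x x1; have [w wx] := cvec_surj x.
by have := vmin w; rewrite /f /r /s wx -!expr2; apply; rewrite inE /S /= wx.
Qed.
End Compactness.

Section Polar.
Variable R : realType.
Implicit Types (t : R) (z : R[i]).

Lemma expj0 : expj 0 = 1 :> R[i].
Proof. by rewrite /expj cos0 sin0. Qed.

Lemma expjD t1 t2 : expj (t1 + t2) = expj t1 * expj t2.
Proof.
rewrite /expj cosD sinD; apply/eqP.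
by rewrite eq_complex /= addrC [X in _ && (X == _)]addrC !eqxx.
Qed.

Lemma expj_period t (k : int) : expj (t + 2 * pi * k%:~R) = expj t.
Proof.
have e : expj (2 * pi) = 1 :> R[i].
  by rewrite mulr_natl /expj cos2pi sin2pi.
have eN m : expj (2 * pi * m%:R) = 1 :> R[i].
  elim: m => [|m IH]; first by rewrite mulr0 expj0.
  by rewrite -[m.+1]addn1 natrD mulrDr mulr1 expjD IH e mulr1.
rewrite expjD; case: k => m; first by rewrite eN mulr1.
rewrite NegzE rmorphN /= mulrN.
have := expjD (2 * pi * m.+1%:R) (- (2 * pi * m.+1%:R)).
by rewrite subrr expj0 eN mul1r => <-; rewrite mulr1.
Qed.

Lemma expj_eq1 t : expj t = 1 -> exists k : int, t = 2 * pi * k%:~R.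
Proof.
move=> t1; pose k := Num.floor (t / (2 * pi)).
have pi0 : 0 < 2 * pi :> R by rewrite mulr_gt0 ?pi_gt0.
exists k; apply/eqP; rewrite -subr_eq0; set u := t - _.
have u1 : expj u = 1 by rewrite /u -mulrN -rmorphN expj_period.
have u0 : 0 <= u by rewrite subr_ge0 mulrC -ler_pdivlMr // floor_le.
have u2 : u < 2 * pi.
  rewrite ltrBlDr -[X in X + _]mulr1 -mulrDr addrC mulrC -ltr_pdivrMr //.
  by have := floorD1_gt (t / (2 * pi)); rewrite intrD.
rewrite eq_le u0 andbT leNgt; apply/negP => up.
have : 0 < sin (u / 2) by rewrite sin_gt0_pi // divr_gt0 //= ltr_pdivrMr // mulrC.
case: u1 => cu _; have : cos u = 1 - 2 * sin (u / 2) ^+ 2.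
  have {1}-> : u = (u / 2) *+ 2 by rewrite -mulr_natr mulfVK ?pnatr_eq0.
  by rewrite cos_mulr2n cos2sin2; ring.
by rewrite cu; nra.
Qed.

Lemma expj_inj t1 t2 :
  expj t1 = expj t2 -> exists k : int, t1 = t2 + 2 * pi * k%:~R.
Proof.
move=> e; have [k kE] : exists k : int, t1 - t2 = 2 * pi * k%:~R.
  by apply: expj_eq1; rewrite expjD e -expjD subrr expj0.
by exists k; rewrite -kE addrC subrK.
Qed.

Lemma unit_circle_expj (a b : R) : a ^+ 2 + b ^+ 2 = 1 ->
  exists2 t, - pi < t <= pi & a +i* b = expj t.
Proof.
move=> ab; have aI : -1 <= a <= 1 by apply/andP; split; nra.
have cs : cos (acos a) = a by rewrite acosK.
have ss : sin (acos a) = `|b|.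
  by rewrite sin_acos // -ab addrC addKr sqrtr_sqr.
have [b0|b0] := leP 0 b.
  exists (acos a); last by rewrite /expj cs ss ger0_norm.
  by rewrite acos_lepi // andbT (lt_le_trans _ (acos_ge0 aI)) // oppr_lt0 pi_gt0.
exists (- acos a); last by rewrite /expj cosN sinN cs ss ltr0_norm // opprK.
have a1 : -1 < a.
  case/andP: aI => a1 _; rewrite lt_neqAle a1 andbT; apply/eqP => a1'.
  move: ab; rewrite -a1' sqrrN expr1n => /eqP.
  by rewrite -subr_eq0 addrC addKr sqrf_eq0 lt_eqF.
rewrite ltrN2 acos_ltpi ?a1 //=; last by case/andP: aI.
by rewrite (le_trans _ (pi_ge0 R)) // oppr_le0 acos_ge0.
Qed.

Lemma polar z : exists2 t, - pi < t <= pi & z = `|z| * expj t.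
Proof.
have [->|z0] := eqVneq z 0.
  by exists 0; rewrite ?normr0 ?mul0r // oppr_lt0 pi_gt0 pi_ge0.
case: z z0 => a b z0; pose r := Num.sqrt (a ^+ 2 + b ^+ 2).
have r0 : r != 0.
  rewrite sqrtr_eq0 -ltNge lt_neqAle addr_ge0 ?sqr_ge0 // andbT eq_sym.
  rewrite paddr_eq0 ?sqr_ge0 // !sqrf_eq0.
  by apply: contra z0 => /andP[/eqP -> /eqP ->].
have r2 : r ^+ 2 = a ^+ 2 + b ^+ 2 by rewrite sqr_sqrtr // addr_ge0 ?sqr_ge0.
have [|t tI e] := @unit_circle_expj (a / r) (b / r).
  by rewrite !expr_div_n -mulrDl -r2 mulfV // sqrf_eq0.
exists t => //; rewrite normc_def -e /= -/r.
by apply/eqP; rewrite eq_complex /= !mul0r subr0 addr0 !(mulrC r) !mulfVK ?eqxx.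
Qed.

Lemma cargP z : z = `|z| * expj (carg z).
Proof.
have [t tI ze] := polar z.
rewrite /carg; case: xgetP => [u _ [] //|/(_ t) []]; by split.
Qed.

Lemma normc_scale_expj (g t : R) : 0 < g -> `|g%:C * expj t| = g%:C.
Proof.
move=> g0; rewrite normc_def /= !mul0r subr0 addr0 !exprMn -mulrDr cos2Dsin2.
by rewrite mulr1 sqrtr_sqr gtr0_norm.
Qed.
End Polar.

Section Separation.
Variable R : realType.

Lemma quartic_ge0_low_coefs (c1 c2 c3 c4 : R) :
  (forall t, 0 <= c1 * t + c2 * t ^+ 2 + c3 * t ^+ 3 + c4 * t ^+ 4) ->
  c1 = 0 /\ 0 <= c2.
Proof.
move=> H; pose K := `|c2| + `|c3| + `|c4|.
have K0 : 0 <= K by rewrite !addr_ge0.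
have c2K : `|c2| <= K by rewrite /K -addrA lerDl addr_ge0.
have mono (c t : R) k : `|t| <= 1 -> c * t ^+ k <= `|c|.
  move=> t1; rewrite (le_trans (ler_norm _)) // normrM normrX.
  by rewrite ler_piMr // exprn_ile1.
have c10 : c1 = 0.
  apply/eqP/negPn/negP => c10; pose M := K + `|c1| + 1.
  have M0 : 0 < M by rewrite /M; have := normr_ge0 c1; lra.
  pose t := - c1 / (2 * M).
  have t1 : `|t| <= 1.
    rewrite /t normrM normrN normfV (@gtr0_norm _ (2 * M)) ?mulr_gt0 //.
    by rewrite ler_pdivrMr ?mulr_gt0 // mul1r /M; have := normr_ge0 c1; lra.
  have := H t.
  have -> : c1 * t + c2 * t ^+ 2 + c3 * t ^+ 3 + c4 * t ^+ 4 =
     c1 * t + t ^+ 2 * (c2 * t ^+ 0 + c3 * t ^+ 1 + c4 * t ^+ 2) by ring.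
  have := mono c2 t 0%N t1; have := mono c3 t 1%N t1; have := mono c4 t 2 t1.
  set z2 := c4 * _; set z1 := c3 * _; set z0 := c2 * _ => h2 h1 h0.
  have c1t : c1 * t = - (2 * (M * t ^+ 2)) by rewrite /t; field; lra.
  have t2 : 0 < t ^+ 2.
    by rewrite exprn_even_gt0 //= /t mulf_neq0 ?oppr_eq0 // invr_eq0; lra.
  have : t ^+ 2 * (z0 + z1 + z2) <= t ^+ 2 * M.
    by rewrite ler_pM2l // /M; have := normr_ge0 c1; rewrite /K; lra.
  by have := mulr_gt0 M0 t2; rewrite c1t; lra.
split=> //; rewrite leNgt; apply/negP => c20.
pose t := - c2 / (2 * (K + 1)).
have t0 : 0 < t by rewrite divr_gt0 ?oppr_gt0 //; lra.
have t1 : `|t| <= 1.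
  rewrite gtr0_norm // /t ler_pdivrMr; last by lra.
  by rewrite mul1r -(ltr0_norm c20); lra.
have := H t; rewrite c10 mul0r add0r.
have -> : c2 * t ^+ 2 + c3 * t ^+ 3 + c4 * t ^+ 4 =
  t ^+ 2 * (c2 + t * (c3 * t ^+ 0 + c4 * t ^+ 1)) by ring.
have := mono c3 t 0%N t1; have := mono c4 t 1%N t1.
set z1 := c4 * _; set z0 := c3 * _ => h1 h0.
have hz : z0 + z1 <= K + 1 by rewrite /K; have := normr_ge0 c2; lra.
have : c2 = - (2 * (t * (K + 1))) by rewrite /t; field; lra.
rewrite pmulr_rge0 ?exprn_gt0 //.
have : t * (z0 + z1) <= t * (K + 1) by rewrite ler_pM2l.
have : 0 < t * (K + 1) by rewrite mulr_gt0 //; lra.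
by lra.
Qed.

Lemma conj_real (r : R) : conjc r%:C = r%:C.
Proof. by rewrite /= oppr0. Qed.

Lemma real_combination_exists (u v : R[i]) :
  exists2 om : R[i], 0 < complex.Re om ^+ 2 + complex.Im om ^+ 2 &
    complex.Im (om * u + conjc om * v) = 0.
Proof.
case: u v => [a b] [c d].
have [|/negbTE pr] := boolP ((b + d == 0) && (a - c == 0)).
  move=> /andP[/eqP p0 _]; exists 1; first by rewrite /= expr1n expr0n addr0.
  by rewrite /= -[RHS]p0; ring.
exists ((c - a) +i* (b + d)); last by rewrite /=; ring.
rewrite /= lt_neqAle addr_ge0 ?sqr_ge0 // andbT eq_sym.
by rewrite paddr_eq0 ?sqr_ge0 // !sqrf_eq0 -opprB oppr_eq0 andbC pr.
Qed.

Lemma sqr_modM (z w : R[i]) :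
  complex.Re (z * w) ^+ 2 + complex.Im (z * w) ^+ 2 =
  (complex.Re z ^+ 2 + complex.Im z ^+ 2) * (complex.Re w ^+ 2 + complex.Im w ^+ 2).
Proof. by case: z w => [a b] [c d] /=; ring. Qed.

Variable n : nat.
Implicit Types (x y : 'cV[R[i]]_n) (A C : 'M[R[i]]_n).

(* Second-order variation of [|<x, A x>|^2 - |x|^4] at its zero [x0]. *)
Lemma Re_ge_of_modulus_ge A x0 : vnorm x0 = 1 -> inner x0 (A *m x0) = 1 ->
  (forall y, (vnorm y ^+ 2) ^+ 2 <=
     complex.Re (inner y (A *m y)) ^+ 2 + complex.Im (inner y (A *m y)) ^+ 2) ->
  forall y, vnorm y ^+ 2 <= rdot y (A *m y).
Proof.
move=> x01 Ax0 H.
have var y (k := inner x0 (A *m y) + inner y (A *m x0)) :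
  complex.Im k = 0 -> vnorm y ^+ 2 <= rdot y (A *m y).
  move=> ki; rewrite /rdot; set w := inner y (A *m y); set b := vnorm y ^+ 2.
  pose be := 2 * rdot x0 y; pose kr := complex.Re k.
  have := @quartic_ge0_low_coefs (2 * (kr - be))
    (2 * complex.Re w + kr ^+ 2 - 2 * b - be ^+ 2)
    (2 * kr * complex.Re w - 2 * be * b)
    (complex.Re w ^+ 2 + complex.Im w ^+ 2 - b ^+ 2).
  case=> [t|/eqP]; last first.
    rewrite mulf_eq0 pnatr_eq0 /= subr_eq0 => /eqP -> ; lra.
  have := H (x0 + t%:C *: y).
  have -> : inner (x0 + t%:C *: y) (A *m (x0 + t%:C *: y)) =
    1 + t%:C * k + (t ^+ 2)%:C * w.
    rewrite mulmxDr -scalemxAr innerDl !innerDr !innerZl !innerZr Ax0 /k /w.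
    rewrite conj_real rmorphXn.
    by move: (inner x0 _) (inner y (A *m x0)) (inner y _) => *; ring.
  have -> : vnorm (x0 + t%:C *: y) ^+ 2 = 1 + t * be + t ^+ 2 * b.
    rewrite sqr_vnorm rdotDl !rdotDr !rdotZl !rdotZr (rdotC x0 y) -!sqr_vnorm x01.
    by rewrite /be /b; move: (rdot _ _) (vnorm _) => *; ring.
  rewrite -subr_ge0 !ReD !ImD !Re_scale !Im_scale ki -/kr.
  move: (complex.Re w) (complex.Im w) => w1 w2 /=.
  congr (_ <= _); ring.
move=> y; set u := inner x0 (A *m y); set v := inner y (A *m x0).
have [om om0 omE] := real_combination_exists u v.
have := var (om *: y); rewrite -!scalemxAr !innerZl !innerZr -/u -/v => /(_ omE).
rewrite sqr_vnormZ /rdot innerZl innerZr -/(rdot _ _).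
have -> : complex.Re (conjc om * (om * inner y (A *m y))) =
  (complex.Re om ^+ 2 + complex.Im om ^+ 2) * complex.Re (inner y (A *m y)).
  by case: om {om0 omE} (inner y _) => [a b] [c d] /=; ring.
by rewrite ler_pM2l.
Qed.

Lemma sectorial_separation C : (0 < n)%N -> sectorial C ->
  exists theta m, 0 < m /\
    forall y, m * vnorm y ^+ 2 <= rdot y (expj (- theta) *: C *m y).
Proof.
move=> n0 Cs; have [x0 x01 x0min] := sphere_attains_min C n0.
set w0 := inner x0 (C *m x0) in x0min.
have w00 : w0 != 0.
  by apply/eqP => w00; apply: Cs; exists x0.
pose A := w0^-1 *: C.
have AE x : inner x (A *m x) = w0^-1 * inner x (C *m x).
  by rewrite /A -scalemxAl innerZr.
pose sq z : R := complex.Re z ^+ 2 + complex.Im z ^+ 2.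
have sqw : sq w0^-1 * sq w0 = 1.
  by rewrite -sqr_modM mulVf //= expr1n expr0n addr0.
have sqw0 : 0 < sq w0.
  rewrite lt_neqAle addr_ge0 ?sqr_ge0 // andbT; apply/eqP => s0.
  by move: sqw; rewrite -s0 mulr0 => /eqP; rewrite eq_sym oner_eq0.
have key : forall y, vnorm y ^+ 2 <= rdot y (A *m y).
  apply: (Re_ge_of_modulus_ge x01); first by rewrite AE mulVf.
  move=> y; have [->|/normalize [u u1 ->]] := eqVneq y 0.
    by rewrite vnorm0 expr0n /= expr0n addr_ge0 ?sqr_ge0.
  set r := vnorm y.
  rewrite -scalemxAr innerZl innerZr conj_real AE.
  rewrite !sqr_modM -/(sq _) -/(sq _) vnormZ_real u1 mulr1.
  rewrite real_normK ?num_real //= -!/(sq _).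
  have := x0min u u1; rewrite -/(sq _) -/(sq (inner u _)) => h.
  have : 1 <= sq w0^-1 * sq (inner u (C *m u)).
    rewrite -sqw ler_pM2l // -(pmulr_lgt0 _ sqw0) sqw //.
  have -> : sq r%:C = r ^+ 2 by rewrite /sq /= expr0n addr0.
  move=> z1; rewrite mulrA -expr2 -[leLHS]mulr1.
  by rewrite ler_wpM2l ?sqr_ge0.
have [th _ w0E] := polar w0.
pose m := Num.sqrt (sq w0).
have m0 : 0 < m by rewrite sqrtr_gt0.
exists th, m; split; [exact: m0|move=> y].
suff -> : rdot y (expj (- th) *: C *m y) = m * rdot y (A *m y) by rewrite ler_pM2l.
rewrite -rdotZr /A scalemxAl scalerA; congr (rdot y (_ *: _ *m y)).
have w0E' : w0 = m%:C * expj th by rewrite {1}w0E normc_def.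
apply: (mulIf w00); rewrite mulfVK // w0E' mulrCA -expjD addNr expj0 mulr1 //.
Qed.
End Separation.

Section Minimizer.
Import numFieldNormedType.Exports.
Variables (R : realType) (n : nat) (C : 'M[R[i]]_n).
Hypothesis n0 : (0 < n)%N.
Implicit Types (theta gamma s : R) (z : R[i]) (x : 'cV[R[i]]_n).

Lemma vnorm_mulmx_ge theta (m : R) :
  (forall y, m * vnorm y ^+ 2 <= rdot y (expj (- theta) *: C *m y)) ->
  forall y, m * vnorm y <= vnorm (C *m y).
Proof.
move=> H y; have [->|y0] := eqVneq y 0; first by rewrite vnorm0 mulr0 vnorm_ge0.
have yp : 0 < vnorm y by rewrite vnorm_gt0.
rewrite -(ler_pM2l yp) mulrCA -expr2 (le_trans (H y)) //.
by apply: le_trans (rdot_le_vnorm _ _) _; rewrite -scalemxAl vnorm_expj.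
Qed.

Lemma phase_spread_lt_pihalf : sectorial C ->
  exists theta, phase_spread C theta < pi / 2.
Proof.
move=> /(sectorial_separation n0) [theta [m [m0 H]]]; exists theta.
have [M M0 CM] := operator_bounded C.
pose c := m / (m + M).
have cI : 0 < c <= 1.
  by rewrite divr_gt0 ?addr_gt0 //= ler_pdivrMr ?addr_gt0 // mul1r lerDl ltW.
have cI' : -1 <= c <= 1 by case/andP: cI => c0 ->; rewrite andbT; lra.
apply: le_lt_trans (_ : acos c < _); last first.
  rewrite ltNge -acos0; apply/negP => h.
  have := acosK (x := c); rewrite in_itv /= cI' => /(_ isT) cE.
  have : cos (acos c) <= cos (acos 0).
    rewrite leNgt; apply/negP; rewrite ltr_cos ?in_itv /= ?acos_ge0 ?acos_lepi //.
    - by rewrite ltNge h.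
    - by rewrite lerN10 ler01.
    - by rewrite lerN10 ler01.
  by rewrite cE acos0 cos_pihalf leNgt; case/andP: cI => ->.
apply/phase_spread_leP; first by rewrite acos_ge0 ?acos_lepi.
move=> x; rewrite acosK ?in_itv //= (le_trans _ (H x)) //.
rewrite /c -mulrA ler_wpM2l ?(ltW m0) // ler_pdivrMl ?addr_gt0 //.
rewrite expr2 mulrCA ler_wpM2l ?vnorm_ge0 //.
by rewrite (le_trans (CM x)) // ler_wpM2r ?vnorm_ge0 // lerDr ltW.
Qed.

Lemma phase_spread_pihalf_itv theta : phase_spread C theta < pi / 2 ->
  0 <= phase_spread C theta <= pi.
Proof.
move=> h; rewrite phase_spread_ge0 (le_trans (ltW h)) //.
by rewrite ler_pdivrMr // ler_peMr ?pi_ge0 // ler1n.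
Qed.

Lemma phase_spread_itv theta : phase_spread C theta < pi / 2 ->
  phase_spread C theta \in `[(- (pi / 2)), pi / 2].
Proof.
move=> h; rewrite in_itv /= (ltW h) andbT (le_trans _ (phase_spread_ge0 _ _)) //.
by rewrite oppr_le0 divr_ge0 ?pi_ge0.
Qed.

Lemma sin_phase_spread_attained theta : (forall x, x != 0 -> C *m x != 0) ->
  phase_spread C theta < pi / 2 -> exists2 gamma, 0 < gamma &
  spectral_norm ((gamma%:C * expj (- theta)) *: C - 1%:M)
    <= sin (phase_spread C theta).
Proof.
move=> Cinj sp; set G := phase_spread C theta.
have GI := phase_spread_pihalf_itv sp.
have c0 : 0 < cos G.
  rewrite cos_gt0_pihalf // sp andbT (lt_le_trans _ (phase_spread_ge0 _ _)) //.
  by rewrite oppr_lt0 divr_gt0 ?pi_gt0.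
have nB x : vnorm (expj (- theta) *: C *m x) = vnorm (C *m x).
  by rewrite -scalemxAl vnorm_expj.
have [|||gamma g0 gB] :=
  @spectral_norm_le_of_rdot_ge R n (expj (- theta) *: C) (cos G) n0 c0.
- by move=> x /Cinj; rewrite -!vnorm_eq0 nB.
- by move=> x; rewrite nB; apply: (phase_spread_leP C theta GI).1.
- exact: cos_le1.
exists gamma => //; move: gB; rewrite scalerA -sin2cos2 sqrtr_sqr ger0_norm //.
exact: sin_ge0_pi.
Qed.

Lemma sin_phase_spread_le_spectral_norm theta gamma : 0 < gamma ->
  phase_spread C theta < pi / 2 ->
  sin (phase_spread C theta) <=
  spectral_norm ((gamma%:C * expj (- theta)) *: C - 1%:M).
Proof.
move=> g0 sp; set s := spectral_norm _.
have [s1|s1] := ltP s 1; last exact: le_trans (sin_le1 _) s1.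
have s0 : 0 <= s by exact: spectral_norm_ge0.
have sI : -1 <= s <= 1 by rewrite (ltW s1) andbT; lra.
have h := phase_spread_le_asin n0 g0 (lexx s) s1.
rewrite -[leRHS](asinK (x := s)) ?in_itv //=.
rewrite leNgt ltr_sin ?phase_spread_itv //; first by rewrite -leNgt.
by rewrite in_itv /= asin_geNpi2 ?asin_lepi2.
Qed.

Lemma minimizer_unique (m : R) (z1 z2 : R[i]) : 0 < m ->
  (forall y, m * vnorm y <= vnorm (C *m y)) ->
  let g z := spectral_norm (z *: C - 1%:M) in
  (forall z, g z1 <= g z) -> g z2 <= g z1 -> z1 = z2.
Proof.
move=> m0 mC g z1min z21; apply/eqP/negPn/negP => z12.
pose s := g z1; have s0 : 0 <= s by exact: spectral_norm_ge0.
pose D := complex.Re (z1 - z2) ^+ 2 + complex.Im (z1 - z2) ^+ 2.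
have D0 : 0 < D.
  rewrite lt_neqAle addr_ge0 ?sqr_ge0 // andbT eq_sym paddr_eq0 ?sqr_ge0 //.
  rewrite !sqrf_eq0; move: z12; rewrite -subr_eq0.
  by case: (z1 - z2) => a b; apply: contra => /andP[/eqP /= -> /eqP /= ->].
pose zm := (2^-1)%:C * (z1 + z2).
pose e := D * m ^+ 2 / 4.
have e0 : 0 < e by rewrite divr_gt0 // mulr_gt0 ?exprn_gt0.
have par x : vnorm ((zm *: C - 1%:M) *m x) ^+ 2 <= (s ^+ 2 - e) * vnorm x ^+ 2.
  set u := (z1 *: C - 1%:M) *m x; set w := (z2 *: C - 1%:M) *m x.
  have uE : (zm *: C - 1%:M) *m x = (2^-1)%:C *: (u + w).
    rewrite /u /w -mulmxDl scalemxAl; congr (_ *m x).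
    rewrite addrACA -scalerDl -opprD scalerBr scalerA; congr (_ - _).
    rewrite -[X in _ *: (X + _)]scale1r -[X in _ *: (_ + X)]scale1r.
    rewrite -scalerDl scalerA; have -> : (2^-1)%:C * (1 + 1) = 1 :> R[i].
      by apply/eqP; rewrite eq_complex /=; apply/andP; split; apply/eqP; field.
    by rewrite scale1r.
  have uw : u - w = (z1 - z2) *: (C *m x).
    by rewrite /u /w -mulmxBl opprB addrA subrK -scalerBl scalemxAl.
  have u2 : vnorm u ^+ 2 <= s ^+ 2 * vnorm x ^+ 2.
    rewrite -exprMn ler_pXn2r ?nnegrE ?mulr_ge0 ?vnorm_ge0 //.
    exact: le_spectral_norm.
  have w2 : vnorm w ^+ 2 <= s ^+ 2 * vnorm x ^+ 2.
    rewrite -exprMn ler_pXn2r ?nnegrE ?mulr_ge0 ?vnorm_ge0 //.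
    apply: le_trans (le_spectral_norm _ _ n0) _.
    by apply: ler_wpM2r; [exact: vnorm_ge0|exact: z21].
  have d2 : D * (m ^+ 2 * vnorm x ^+ 2) <= vnorm (u - w) ^+ 2.
    rewrite uw sqr_vnormZ -/D ler_pM2l // -exprMn.
    by rewrite ler_pXn2r ?nnegrE ?mulr_ge0 ?vnorm_ge0 // ltW.
  have := parallelogram u w.
  rewrite uE vnormZ_real exprMn real_normK ?num_real // /e.
  clearbody u w; clear uE uw; clear -u2 w2 d2.
  move: (vnorm (u + w) ^+ 2) (vnorm (u - w) ^+ 2) d2 => X Y d2.
  move: (vnorm u ^+ 2) (vnorm w ^+ 2) (vnorm x ^+ 2) u2 w2 d2 => U W Z u2 w2 d2 XY.
  have -> : 2^-1 ^+ 2 = 4^-1 :> R by field.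
  by rewrite ler_pdivrMl //; lra.
have [x1 x11] := unit_vector_exists R n0.
have se : 0 <= s ^+ 2 - e.
  by have := par x1; rewrite x11 expr1n mulr1; apply/le_trans/sqr_ge0.
have : s <= Num.sqrt (s ^+ 2 - e).
  apply: le_trans (z1min zm) _; apply/(spectral_normP _ n0) => x.
  rewrite -(ler_pXn2r (n := 2)) ?nnegrE ?mulr_ge0 ?vnorm_ge0 ?sqrtr_ge0 //.
  by rewrite exprMn (@sqr_sqrtr _ (s ^+ 2 - e)).
rewrite -(ler_pXn2r (n := 2)) ?nnegrE ?sqrtr_ge0 // sqr_sqrtr //.
by rewrite lerBrDr gerDl leNgt e0.
Qed.

Lemma minimizer_exists (m : R) : 0 < m ->
  (forall y, m * vnorm y <= vnorm (C *m y)) ->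
  exists z1, forall z,
    spectral_norm (z1 *: C - 1%:M) <= spectral_norm (z *: C - 1%:M).
Proof.
move=> m0 mC; pose g z := spectral_norm (z *: C - 1%:M).
have [M M0 CM] := operator_bounded C.
have nz (a : R[i]) x :
  vnorm (a *: x) <= (`|complex.Re a| + `|complex.Im a|) * vnorm x.
  rewrite -(ler_pXn2r (n := 2)) ?nnegrE ?mulr_ge0 ?addr_ge0 ?vnorm_ge0 //.
  rewrite sqr_vnormZ exprMn ler_wpM2r ?sqr_ge0 //.
  rewrite -(real_normK (num_real (complex.Re a))).
  rewrite -(real_normK (num_real (complex.Im a))) sqrrD.
  by rewrite -[leRHS]addrA [X in _ <= _ + X]addrC addrA lerDl mulrn_wge0 ?mulr_ge0.
have gL z w : g z <= g w + (`|complex.Re (z - w)| + `|complex.Im (z - w)|) * M.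
  apply/(spectral_normP _ n0) => x.
  have -> : (z *: C - 1%:M) *m x = (w *: C - 1%:M) *m x + (z - w) *: (C *m x).
    rewrite scalemxAl -mulmxDl; congr (_ *m x).
    by rewrite scalerBl [RHS]addrC subrKA.
  rewrite (le_trans (vnormD _ _)) // mulrDl lerD ?le_spectral_norm //.
  by rewrite (le_trans (nz _ _)) // -mulrA ler_wpM2l ?addr_ge0.
have g0 : g 0 <= 1.
  apply/(spectral_normP _ n0) => x.
  by rewrite scale0r sub0r mulNmx mul1mx vnormN mul1r.
pose K := 2 / m; have K0 : 0 < K by rewrite divr_gt0.
have far z : K ^+ 2 <= complex.Re z ^+ 2 + complex.Im z ^+ 2 -> 1 <= g z.
  move=> zK; have [x x1] := unit_vector_exists R n0.
  have : vnorm (z *: (C *m x)) <= g z + 1.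
    have -> : z *: (C *m x) = (z *: C - 1%:M) *m x + x.
      by rewrite mulmxBl mul1mx subrK scalemxAl.
    rewrite (le_trans (vnormD _ _)) // x1 lerD2r.
    by rewrite -[leRHS]mulr1 -x1 le_spectral_norm.
  have : 2 <= vnorm (z *: (C *m x)).
    rewrite -(ler_pXn2r (n := 2)) ?nnegrE ?vnorm_ge0 // sqr_vnormZ.
    have -> : 2 ^+ 2 = K ^+ 2 * m ^+ 2 :> R by rewrite /K; field; lra.
    rewrite ler_pM ?sqr_ge0 // ler_pXn2r ?nnegrE ?vnorm_ge0 ?(ltW m0) //.
    by have := mC x; rewrite x1 mulr1.
  by move=> h2 h1; rewrite -(lerD2r 1); exact: le_trans h2 h1.
pose zz (v : 'rV[R]_2) : R[i] := v 0 0 +i* v 0 1.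
pose S := [set v : 'rV[R]_2 | forall i, `[(- K : R), K]%classic (v ord0 i)].
have Sc : compact S.
  by apply: (@rV_compact R 2 (fun=> `[(- K : R), K]%classic)) => _;
    exact: segment_compact.
have S0 : S 0.
  by move=> i; rewrite /= in_itv /= mxE oppr_le0 ltW.
have fc : continuous (fun v => g (zz v)).
  apply: (@continuous_of_modulus R 'rV[R]_2 _ (fun v => v 0 0) (fun v => v 0 1) M).
  - exact: coord_continuous.
  - exact: coord_continuous.
  - by move=> v w; exact: (gL (zz v) (zz w)).
have [v vS vmin] := EVT_min_rV (ex_intro _ 0 S0) Sc (continuous_subspaceT fc).
exists (zz v) => z; rewrite -/(g _) -/(g z).
have gv0 : g (zz v) <= 1.
  apply: le_trans g0; have := vmin 0; rewrite inE => /(_ S0).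
  by congr (_ <= g _); rewrite /zz !mxE.
have [zK|zK] := leP (K ^+ 2) (complex.Re z ^+ 2 + complex.Im z ^+ 2).
  by apply: le_trans gv0 (far _ zK).
have := vmin (\row_i (if i == 0 then complex.Re z else complex.Im z)).
rewrite inE {2}/zz !mxE /=.
have -> : complex.Re z +i* complex.Im z = z by case: z {zK}.
apply => i; rewrite /= in_itv /= mxE -ler_norml.
rewrite -(ler_pXn2r (n := 2)) ?nnegrE ?(ltW K0) // real_normK ?num_real //.
by apply: ltW; apply: le_lt_trans zK; case: ifP => _; rewrite ?lerDl ?lerDr sqr_ge0.
Qed.

End Minimizer.

Lemma phase_spread_expj (R : realType) (n : nat) (C : 'M[R[i]]_n) (t1 t2 : R) :
  expj (- t1) = expj (- t2) -> phase_spread C t1 = phase_spread C t2.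
Proof.
move=> e.
have E (x y : 'cV[R[i]]_n) : angle t1 x y = angle t2 x y by rewrite /angle e.
apply: (congr1 (@sup R)); apply/seteqP; split=> _ [x _ <-].
  by exists x; rewrite ?E.
by exists x; rewrite ?E.
Qed.

Lemma translated_itv (R : realType) (theta a : R) :
  [set theta + t | t in `[- a, a]] = `[theta - a, theta + a]%classic.
Proof.
apply/seteqP; split=> [_ [t /= + <-]|u /=]; rewrite !in_itv /=.
  by rewrite !lerD2l.
move=> uI; exists (u - theta); last by rewrite addrC subrK.
by move: uI; rewrite in_itv /= => /andP[? ?]; apply/andP; split; lra.
Qed.

Lemma spectral_norm_scale0_ge1 (R : realType) (n : nat) (C : 'M[R[i]]_n) :
  (0 < n)%N -> 1 <= spectral_norm (0 *: C - 1%:M).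
Proof.
move=> n0; have [x x1] := unit_vector_exists R n0.
have := le_spectral_norm (0 *: C - 1%:M) x n0.
by rewrite scale0r sub0r mulNmx mul1mx vnormN x1 mulr1.
Qed.

Section Optimal.
Variables (R : realType) (n : nat) (C : 'M[R[i]]_n).
Hypotheses (n0 : (0 < n)%N) (Cs : sectorial C).

Let g (z : R[i]) := spectral_norm (z *: C - 1%:M).

Lemma sectorial_mulmx_neq0 (x : 'cV[R[i]]_n) : x != 0 -> C *m x != 0.
Proof.
have [th [m [m0 /vnorm_mulmx_ge mC]]] := sectorial_separation n0 Cs.
rewrite -!vnorm_gt0 => x0; apply: lt_le_trans (mC x).
by rewrite mulr_gt0.
Qed.

Lemma sectorial_minimizer_unique z1 z2 :
  (forall z, g z1 <= g z) -> g z2 <= g z1 -> z1 = z2.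
Proof.
have [th [m [m0 /vnorm_mulmx_ge mC]]] := sectorial_separation n0 Cs.
exact: (minimizer_unique n0 m0 mC).
Qed.

Lemma sectorial_minimizer_exists : exists z1, forall z, g z1 <= g z.
Proof.
have [th [m [m0 /vnorm_mulmx_ge mC]]] := sectorial_separation n0 Cs.
exact: (minimizer_exists n0 m0 mC).
Qed.

Lemma sin_phase_spread_lt1 theta : phase_spread C theta < pi / 2 ->
  sin (phase_spread C theta) < 1.
Proof.
move=> sp; rewrite -[ltRHS]sin_pihalf ltr_sin ?phase_spread_itv //.
by rewrite in_itv /= lexx andbT ge0_cp ?divr_ge0 ?pi_ge0.
Qed.

Variable z : R[i].
Hypothesis zmin : forall w, g z <= g w.

Lemma minimizer_lt1 : g z < 1.
Proof.
have [th sp] := phase_spread_lt_pihalf n0 Cs.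
have [gam _ gs] := sin_phase_spread_attained n0 sectorial_mulmx_neq0 sp.
apply: le_lt_trans (zmin _) _; apply: le_lt_trans gs _.
exact: sin_phase_spread_lt1.
Qed.

Lemma minimizer_neq0 : z != 0.
Proof.
by apply: contraTneq minimizer_lt1 => ->; rewrite -leNgt spectral_norm_scale0_ge1.
Qed.

Lemma minimizer_itv : -1 <= g z < 1.
Proof.
by rewrite minimizer_lt1 andbT (le_trans _ (spectral_norm_ge0 _ n0)) // lerN10.
Qed.

Lemma asin_le_phase_spread theta : asin (g z) <= phase_spread C theta.
Proof.
have /andP[g1 g2] := minimizer_itv.
have aI : asin (g z) \in `[(- (pi / 2)), pi / 2].
  by rewrite in_itv /= asin_geNpi2 ?asin_lepi2 ?g1 ?ltW.
have [sp|sp] := ltP (phase_spread C theta) (pi / 2); last first.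
  by rewrite (le_trans _ sp) // asin_lepi2 // g1 ltW.
have [gam _ gs] := sin_phase_spread_attained n0 sectorial_mulmx_neq0 sp.
rewrite leNgt -ltr_sin ?phase_spread_itv // asinK ?in_itv /= ?g1 ?(ltW g2) //.
by rewrite -leNgt; apply: le_trans gs; exact: zmin.
Qed.

Lemma minimizer_polar : exists2 r : R, 0 < r & z = r%:C * expj (carg z).
Proof.
exists (complex.Re `|z|); last first.
  by rewrite {1}(cargP z) normc_def.
have := minimizer_neq0; rewrite -normr_gt0 ltcE => /andP[_].
by [].
Qed.

Lemma phase_spread_Ncarg : phase_spread C (- carg z) = asin (g z).
Proof.
apply/eqP; rewrite eq_le asin_le_phase_spread andbT.
have [r r0 zE] := minimizer_polar.
by apply: (phase_spread_le_asin n0 r0 _ minimizer_lt1); rewrite opprK -zE.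
Qed.

Lemma phase_spread_eq_asin theta : phase_spread C theta = asin (g z) ->
  exists k : int, theta = - carg z + 2 * pi * k%:~R.
Proof.
have /andP[g1 g2] := minimizer_itv.
move=> e; have sp : phase_spread C theta < pi / 2.
  by rewrite e asin_ltpi2 // g1.
have [gam gam0] := sin_phase_spread_attained n0 sectorial_mulmx_neq0 sp.
rewrite e asinK; last by rewrite in_itv /= g1 ltW.
move=> gz.
have zE := sectorial_minimizer_unique zmin gz.
have nE : `|z| = gam%:C by rewrite zE normc_scale_expj.
have : expj (carg z) = expj (- theta).
  have gam0' : gam%:C != 0 by rewrite -nE normr_eq0 minimizer_neq0.
  by apply: (mulfI gam0'); rewrite -zE -nE -cargP.
by case/expj_inj => k kE; exists k; rewrite kE; ring.
Qed.

Lemma argmin_phase_spread : argmin [set: R] (phase_spread C) =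
  [set theta | phase_spread C theta = asin (g z)].
Proof.
apply/seteqP; split=> [t [_ h]|t /= e].
  apply/eqP; rewrite eq_le asin_le_phase_spread andbT -phase_spread_Ncarg.
  exact: h.
by split=> [//|y _]; rewrite e; exact: asin_le_phase_spread.
Qed.

Lemma argmin_phase_spreadE : argmin [set: R] (phase_spread C) =
  [set - carg z + 2 * pi * k%:~R | k in [set: int]].
Proof.
rewrite argmin_phase_spread; apply/seteqP.
split=> [t /phase_spread_eq_asin|_ [k _ <-]].
  by case=> k kE; exists k.
rewrite /= -phase_spread_Ncarg; apply: phase_spread_expj.
have -> : - (- carg z + 2 * pi * k%:~R) = - - carg z + 2 * pi * (- k)%:~R.
  by rewrite rmorphN; ring.
by rewrite expj_period.
Qed.
End Optimal.

Theorem theorem1 (R : realType) (n : nat) (C : 'M[R[i]]_n)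
    (n_gt0 : (0 < n)%N) (C_sectorial : sectorial C) :
  (* (i) *)
  (forall theta : R, phase_spread C theta < pi / 2 ->
     let f (gamma : R) :=
       spectral_norm ((gamma%:C * expj (- theta)) *: C - 1%:M) in
     argmin [set gamma : R | 0 < gamma] f !=set0 /\
     forall gamma : R, argmin [set gamma : R | 0 < gamma] f gamma ->
       seg_phase C theta =
         [set theta + t | t in `[- asin (f gamma), asin (f gamma)]]) /\
  (* (ii) *)
  (let g (z : R[i]) := spectral_norm (z *: C - 1%:M) in
   argmin [set: R[i]] g !=set0 /\
   forall z : R[i], argmin [set: R[i]] g z ->
     [/\ z != 0,
         argmin [set: R] (phase_spread C) =
           [set - carg z + 2 * pi * k%:~R | k in [set: int]]
       & forall theta : R, argmin [set: R] (phase_spread C) theta ->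
           phase_spread C theta = asin (g z) /\
           seg_phase C theta =
             [set theta + t | t in `[- asin (g z), asin (g z)]]]).
Proof.
split=> [theta sp f|g].
  have GI := phase_spread_itv sp.
  have C_inj := sectorial_mulmx_neq0 n_gt0 C_sectorial.
  have [gam gam0 gs] := sin_phase_spread_attained n_gt0 C_inj sp.
  have ge gamma : 0 < gamma -> sin (phase_spread C theta) <= f gamma.
    by move=> g0; exact: sin_phase_spread_le_spectral_norm.
  split.
    exists gam; split; [exact: gam0|move=> y y0].
    exact: le_trans gs (ge _ y0).
  move=> gamma [/= g0 gmin].
  have -> : f gamma = sin (phase_spread C theta).
    apply: le_anti; rewrite (ge _ g0) andbT.
    exact: le_trans (gmin _ gam0) gs.
  by rewrite sinK // translated_itv.
split.
  have [z zmin] := sectorial_minimizer_exists n_gt0 C_sectorial.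
  by exists z; split=> [//|y _]; exact: zmin.
move=> z [_ zmin'].
have zmin w : g z <= g w by exact: zmin'.
split.
- exact: minimizer_neq0 zmin.
- exact: argmin_phase_spreadE.
move=> theta; rewrite (argmin_phase_spread n_gt0 C_sectorial zmin) /= => e.
by split; [exact: e|rewrite /seg_phase e translated_itv].
Qed.
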